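(* Let $G$ be a profinite group such that the set $\{x\in G : x^3=1\}$ has positive Haar measure. Then the set $\{x\in G : x^3=1\}$ has non-empty interior in $G$.
   Context: Haar measure means the normalized Haar measure of $G$. *)

(* Defs.v *)
From HB Require Import structures.
From mathcomp Require Import all_boot all_order all_algebra.
From mathcomp Require Import all_classical all_reals all_analysis.
Set Implicit Arguments. Unset Strict Implicit. Unset Printing Implicit Defensive.
Import Order.TTheory GRing.Theory Num.Theory.
Local Open Scope classical_set_scope.
Local Open Scope ring_scope.
Local Open Scope ereal_scope.

Definition is_group {G : Type} (mul : G -> G -> G) (inv : G -> G) (one : G) :=
  [/\ forall x y z, mul x (mul y z) = mul (mul x y) z,
      forall x, mul one x = x,
      forall x, mul x one = x,
      forall x, mul (inv x) x = one &
      forall x, mul x (inv x) = one].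

Definition is_topological_group {G : topologicalType}
  (mul : G -> G -> G) (inv : G -> G) (one : G) :=
  [/\ is_group mul inv one,
      continuous (fun p : G * G => mul p.1 p.2) &
      continuous inv].

Definition is_profinite_group {G : topologicalType}
  (mul : G -> G -> G) (inv : G -> G) (one : G) :=
  [/\ is_topological_group mul inv one,
      compact [set: G],
      hausdorff_space G &
      totally_disconnected [set: G]].

Notation borelType G := (g_sigma_algebraType (@open G)).

Definition is_normalized_haar {R : realType} {G : ptopologicalType}
  (mul : G -> G -> G) (mu : {measure set (borelType G) -> \bar R}) :=
  [/\ mu [set: borelType G] = 1,
      (forall (g : G) (A : set (borelType G)), measurable A ->
          mu [set mul g x | x in A] = mu A),
      (forall A : set (borelType G), measurable A ->
          mu A = ereal_sup [set mu K | K in [set K : set G | compact K /\ K `<=` A]]) &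
      (forall A : set (borelType G), measurable A ->
          mu A = ereal_inf [set mu U | U in [set U : set G | open U /\ A `<=` U]])].

(* Main.v *)
Require Import Defs.
From HB Require Import structures.
From mathcomp Require Import all_boot all_order all_algebra.
From mathcomp Require Import all_fingroup all_solvable finmap.
From mathcomp Require Import all_classical all_reals all_analysis.
Import Order.TTheory GRing.Theory Num.Theory.
Set Implicit Arguments. Unset Strict Implicit. Unset Printing Implicit Defensive.

(** Let [X] be the set of solutions of [x^3 = 1]. By outer regularity and
compactness, [X] fills all but a tiny proportion of some coset [y N], where [N]
is an open normal subgroup and [y] is in [X]; it suffices to prove that [y N] is
contained in [X], and this may be checked in every finite quotient.

In a finite group put [a' = a^y] and [tau a = a'' a' a], so that [(y a)^3 = tau a]
and [tau a = 1] for almost all [a] in [N]. Applying this to [a], [b] and a few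
words in [a], [b] and their conjugates shows that [a] commutes with [a^b] for
almost all pairs. As in Levi's theorem on 2-Engel groups, it follows that
[[a,b,c,d] = 1] for almost all quadruples; since a subgroup of density greater
than 1/2 is the whole group, [N] is nilpotent of class at most 3. Then for a fixed
[n] and almost all [a], [b] in [N], [tau n] is equal to an expression that is
multiplicative in [b], hence [tau n = (tau n)^2] and [tau n = 1]. *)

(** * Levi's commutator calculus, run from individual Engel conditions *)

Section CommutatorIdentities.
Local Open Scope group_scope.
Variable gT : finGroupType.
Implicit Types a b c d u v w x y z : gT.

Definition engel x w := x * x ^ w == x ^ w * x.

Lemma engelP x w : reflect (commute x (x ^ w)) (engel x w).
Proof. exact: eqP. Qed.

Lemma commuteMl x y z : commute x z -> commute y z -> commute (x * y) z.
Proof. by move=> xz yz; apply/commute_sym/commuteM; apply: commute_sym. Qed.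

Lemma commuteVl x y : commute x y -> commute x^-1 y.
Proof. by move=> xy; apply/commute_sym/commuteV/commute_sym. Qed.

Lemma commuteJ x y z : commute x y -> commute (x ^ z) (y ^ z).
Proof. by move=> xy; rewrite /commute -!conjMg xy. Qed.

Lemma commute_conjg x y : commute x y -> x ^ y = x.
Proof. by move=> xy; rewrite conjgE xy mulKg. Qed.

Lemma conjg_commute x y : x ^ y = x -> commute x y.
Proof. by rewrite conjgE => xy; rewrite /commute -{2}xy mulKVg. Qed.

Lemma engelJ x v w : engel x (w * v^-1) -> commute (x ^ v) (x ^ w).
Proof. by move/engelP/(@commuteJ _ _ v); rewrite -conjgM mulgKV. Qed.

Lemma engelV x w : engel x^-1 w = engel x w.
Proof. by rewrite /engel conjVg -!invMg (inj_eq invg_inj) eq_sym. Qed.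

Lemma commute_commgR x w : engel x w -> commute [~ w, x] x.
Proof.
move/engelP=> xw; rewrite commgEr; apply: commuteMl => //.
by rewrite conjVg; apply/commuteVl/commute_sym.
Qed.

Lemma engel_commg x w : commute [~ w, x] x -> engel x w.
Proof.
move=> cwx; apply/engelP.
have -> : x ^ w = x * [~ w, x]^-1 by rewrite commgEr invMg mulKVg conjVg invgK.
by apply: commuteM => //; apply/commuteV/commute_sym.
Qed.

Lemma commute_commgl x y : commute x (x ^ y) -> commute x [~ x, y].
Proof. by move=> xy; apply: commuteM => //; apply: commuteV. Qed.

Lemma commVg_commute x y : commute x (x ^ y) -> [~ x^-1, y] = [~ x, y]^-1.
Proof. by move=> /commute_commgl/commVg. Qed.

(** Here [[~ a, b^-1 * c]] is [[~ a, c]] times the conjugate by [c] of [[~ a, b]^-1], and it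
    commutes with [b^-1 * c]. Conjugating it by [c^-1 * b] and dropping the conjugations that act
    trivially gives the identity. *)
Lemma commg_swap a b c :
    engel b a -> engel c a -> engel (b^-1 * c) a ->
  [~ a, c, b] = [~ a, b, c]^-1.
Proof.
move=> /commute_commgR eb /commute_commgR fc /commute_commgR.
rewrite commgMJ commgV; last exact: commute_sym.
move: [~ a, b] [~ a, c] eb fc => e f eb fc.
move=> /commute_conjg /(congr1 (conjg^~ (c^-1 * b))).
rewrite -conjgM (_ : b^-1 * c * (c^-1 * b) = 1) ?conjg1; last first.
  by rewrite mulgA mulgK mulVg.
rewrite conjMg -[(e^-1 ^ c) ^ _]conjgM mulKVg conjgM.
rewrite (commute_conjg (commuteV fc)) (commute_conjg (commuteVl eb)) => efb.
rewrite [[~ f, b]]commgEl [[~ e, c]]commgEl invMg invgK -conjVg.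
by rewrite -(mulKg f (e^-1 ^ c)) efb !mulgA mulgKV.
Qed.

(** The first three conditions are those of [commg_swap]; the last four say that [c] and [c ^ a]
    both commute with [c ^ b] and [c ^ (a * b)]. *)
Definition tri_generic a b c :=
  [&& engel b a, engel c a, engel (b^-1 * c) a, engel c b, engel c (a * b),
      engel c (b * a^-1) & engel c (a * b * a^-1)].

Lemma tri_comm a b c : tri_generic a b c -> commute [~ c, a] ([~ c, a] ^ b).
Proof.
case/and5P=> _ /engelP ca _ /engelP cb /and3P[/engelP cab cba caba].
rewrite commgEl conjMg -conjgM conjVg.
move/engelJ: cba => cba; move/engelJ: caba => caba.
by apply: commuteMl; [apply: commuteVl|]; apply: commuteM => //; apply: commuteV.
Qed.

Lemma tri_rot a b c : tri_generic a b c -> [~ a, b, c] = [~ c, a, b].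
Proof.
move=> T; case/and5P: (T) => ba ca bca cb _.
rewrite -[LHS]invgK -commg_swap // -(invg_comm c a).
by rewrite commVg_commute ?invgK //; apply: tri_comm T.
Qed.

(** After rotation to [[~ c, a, b]], the commutator is a word in [c], [c ^ a], [c ^ b] and
    [c ^ (a * b)], all of which commute with [c]. *)
Lemma tri_commr a b c : tri_generic a b c -> commute [~ a, b, c] c.
Proof.
move=> T; rewrite (tri_rot T).
case/and5P: T => _ /engelP ca _ /engelP cb /and3P[/engelP cab _ _].
rewrite !commgEl conjMg -conjgM conjVg invMg invgK.
by apply/commute_sym; do ?apply: commuteM => //; apply: commuteV.
Qed.

Lemma tri_engel a b c : tri_generic a b c -> engel c [~ a, b].
Proof. by move/tri_commr/engel_commg. Qed.

Lemma tri_swap a b c : tri_generic a b c -> [~ a, c, b] = [~ a, b, c]^-1.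
Proof. by case/and5P=> *; apply: commg_swap. Qed.

(** Each factor of the Hall-Witt identity reduces to [[~ a, b, c]^-1]: the conjugations are trivial
    because this element commutes with [a], [b] and [c]. *)
Lemma tri_cube a b c : tri_generic a b c -> tri_generic b c a ->
  tri_generic c a b -> [~ a, b, c] ^+ 3 = 1.
Proof.
move=> Ta Tb Tc; have := Hall_Witt_identity a b c.
have comV x y z : tri_generic x y z -> tri_generic y z x ->
    [~ x, y^-1, z] = [~ x, y, z]^-1.
  move=> T T'; rewrite commgV; last by case/and5P: T => /commute_commgR/commute_sym.
  exact/commVg_commute/(tri_comm T').
rewrite !comV // (tri_rot Tb) -(tri_rot Ta); set u := [~ a, b, c].
have uc : commute u c by apply: tri_commr Ta.
have ua : commute u a by rewrite /u -(tri_rot Tb); apply: tri_commr Tb.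
have ub : commute u b by rewrite /u (tri_rot Ta); apply: tri_commr Tc.
rewrite !(commute_conjg (commuteVl _)) // -!invMg => /(congr1 invg).
by rewrite invgK invg1 expgS expg2 mulgA.
Qed.

(** [[~ a, b, c]] is a word in the conjugates of [a] by [1], [b], [c] and [b * c]. By [engelJ], the
    conditions make each of these commute with the conjugate by [d] of each of them. *)
Definition quad_generic a b c d :=
  all (fun v => all (fun w => engel a (v * d * w^-1)) [:: 1; b; c; b * c])
      [:: 1; b; c; b * c].

Lemma quad_comm a b c d : quad_generic a b c d ->
  commute [~ a, b, c] ([~ a, b, c] ^ d).
Proof.
move=> /allP Q.
have cvw v w : v \in [:: 1; b; c; b * c] -> w \in [:: 1; b; c; b * c] ->
    commute (a ^ w) ((a ^ v) ^ d).
  by move=> v_in w_in; rewrite -conjgM; apply: engelJ; have /allP := Q _ v_in; apply.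
have commuteMVM x p q r s : commute x p -> commute x q -> commute x r -> commute x s ->
    commute x (p^-1 * q * r^-1 * s).
  by move=> xp xq xr xs; do 3?apply: commuteM => //; apply: commuteV.
have E : [~ a, b, c] = (a ^ b)^-1 * a ^ 1 * (a ^ c)^-1 * a ^ (b * c).
  by rewrite !commgEl conjMg conjVg conjgM conjg1 invMg invgK !mulgA.
rewrite {1}E; apply/commute_sym.
by apply: (commuteMVM); rewrite E 3!conjMg 2!conjVg; apply/commute_sym/commuteMVM;
  apply: (cvw); rewrite !inE eqxx ?orbT.
Qed.

(* Both [[a,b],[c,d]] and its inverse [[c,d],[a,b]] are equal to the alternating
form [a,b,c,d], whose cube is trivial. *)
Lemma commg4_eq1 a b c d :
    tri_generic a b c -> tri_generic b c a -> tri_generic c a b ->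
    tri_generic c a d -> tri_generic c a (b^-1 * d) -> tri_generic d a c ->
    quad_generic a b c d -> quad_generic c d a b ->
    engel (b^-1 * [~ c, d]) a -> engel (d^-1 * [~ a, b]) c ->
  [~ a, b, c, d] = 1.
Proof.
move=> Tabc Tbca Tcab Tcad Tcabd Tdac /quad_comm Qa /quad_comm Qc eb ed.
have half x y z t : engel y x -> engel (y^-1 * [~ z, t]) x -> tri_generic t x z ->
    commute [~ z, t, x] ([~ z, t, x] ^ y) ->
  [~ x, y, [~ z, t]] = [~ z, t, x, y].
  move=> yx yztx T Q; rewrite -[LHS]invgK -commg_swap //.
    by rewrite -(invg_comm [~ z, t]) commVg_commute // invgK.
  exact/engelP/(tri_comm T).
have Y1 : [~ a, b, [~ c, d]] = [~ c, d, a, b].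
  by apply: half => //; case/and5P: Tabc.
have Y2 : [~ c, d, [~ a, b]] = [~ a, b, c, d].
  by apply: half => //; case/and5P: Tcad.
(* Rotate to [[~ c, a, b, d]], swap [b] with [d], then [a] with [d]; the two inversions cancel. *)
have par : [~ a, b, c, d] = [~ c, d, a, b].
  rewrite (tri_rot Tabc) -[LHS]invgK -commg_swap ?tri_engel //.
  by rewrite -[[~ c, a, d]]invgK -tri_swap // commVg_commute ?invgK.
have X2 : [~ a, b, c, d] * [~ a, b, c, d] = 1.
  by rewrite -{1}Y2 par -Y1 -invg_comm mulVg.
have X3 : [~ a, b, c, d] ^+ 3 = 1.
  by rewrite -commXg ?tri_cube ?comm1g //; apply: commute_commgl.
by move: X3; rewrite expgS expg2 X2 mulg1.
Qed.
End CommutatorIdentities.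

(** * Endomorphisms with cube the identity, and elements of trivial norm *)

Section Splitting.
Local Open Scope group_scope.
Variables (gT : finGroupType) (f : gT -> gT).
Hypotheses (fM : {morph f : x y / x * y}) (f3 : forall x, f (f (f x)) = x).
Implicit Types a b n x y z t w : gT.

(** An automorphism of order 3 for which this product is always trivial is called a splitting
    automorphism. *)
Definition splitting_norm a := f (f a) * f a * a.
Notation tau := splitting_norm.

Let f1 : f 1 = 1.
Proof. by apply: (mulgI (f 1)); rewrite -fM !mulg1. Qed.

Let fV a : f a^-1 = (f a)^-1.
Proof. by apply/eqP; rewrite eq_sym eq_invg_mul -fM mulgV f1. Qed.

Let fJ a b : f (a ^ b) = f a ^ f b.
Proof. by rewrite !conjgE !fM fV. Qed.

Let fcommute a b : commute a b -> commute (f a) (f b).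
Proof. by move=> ab; rewrite /commute -!fM ab. Qed.

Lemma splitting_norm_comm a : tau a = 1 -> tau a^-1 = 1 ->
  commute a (f a) /\ f (f a) = (a * f a)^-1.
Proof.
rewrite /tau !fV -!invMg => ta /(congr1 invg); rewrite invgK invg1 mulgA => ta'.
have -> : f (f a) = (a * f a)^-1 by apply/eqP; rewrite eq_sym eq_invg_mul ta'.
split=> //; apply: (mulgI (f (f a))); rewrite !mulgA ta.
by apply: (mulIg (f (f a))); rewrite mul1g -!mulgA (mulgA a) ta' mulg1.
Qed.

Lemma splitting_norm_mul a n : tau a = 1 -> tau a^-1 = 1 -> tau (a * n) = 1 ->
  f a ^ (f (f n))^-1 * tau n * a ^ n = a * f a.
Proof.
move=> ta /(splitting_norm_comm ta)[_ fa2]; rewrite /tau !fM fa2 => /eqP.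
rewrite -!mulgA -eq_invg_mul invgK => /eqP ->.
by rewrite !conjgE invgK !mulgA !(mulgK, mulgKV).
Qed.

(** [splitting_norm_mul] for [a] and for [a^-1] gives the product of [a ^ b] and a conjugate of
    [f a] in both orders. Both products equal [a * f a], the inverse of [f (f a)], so [a ^ b]
    commutes with it. *)
Lemma splitting_comm a b : tau a = 1 -> tau a^-1 = 1 -> tau (a * b) = 1 ->
  tau (a^-1 * b) = 1 -> tau b = 1 -> commute (a ^ b) (f (f a)).
Proof.
move=> ta ta' tab ta'b tb; have [cfa ffa] := splitting_norm_comm ta ta'.
have := splitting_norm_mul ta ta' tab; rewrite tb mulg1.
have := @splitting_norm_mul a^-1 b ta'; rewrite invgK => /(_ ta ta'b).
rewrite tb mulg1 !fV !conjVg -!invMg => /invg_inj; rewrite -cfa ffa => e1 e2.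
by apply: commuteV; rewrite /commute -{1}e2 mulgA e1.
Qed.

(** [splitting_comm] at [f (f b)], transported by [f], and at [b^-1], conjugated by [b], show that
    [a] commutes with [f a ^ b] and [f (f a) ^ b]. Their product in the reverse order is the inverse
    of [a ^ b]. *)
Lemma splitting_engel a b : tau a = 1 -> tau a^-1 = 1 -> tau b = 1 -> tau b^-1 = 1 ->
  tau (a * f (f b)) = 1 -> tau (a^-1 * f (f b)) = 1 -> tau (a * b^-1) = 1 ->
  tau (a^-1 * b^-1) = 1 -> engel a b.
Proof.
move=> ta ta' tb tb' t1 t2 t3 t4; apply/engelP.
have tfb : tau (f (f b)) = 1 by rewrite -[RHS]f1 -f1 -tb /tau !fM !f3.
have c1 := fcommute (splitting_comm ta ta' t1 t2 tfb).
rewrite fJ !f3 in c1.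
have := commuteJ b (splitting_comm ta ta' t3 t4 tb').
rewrite -conjgM mulVg conjg1 => c2.
have -> : a ^ b = (f (f a) ^ b * f a ^ b)^-1.
  by rewrite -conjMg -conjVg; congr (_ ^ _); apply/eqP; rewrite eq_sym eq_invg_mul -ta.
by apply/commuteV/commuteM => //; apply: commute_sym.
Qed.

(** * Triviality of the norm in nilpotency class at most 3 *)

Section ClassThree.
Hypothesis cl3 : forall x y z t : gT, [~ x, y, z, t] = 1.

Let central3 x y z t : commute [~ x, y, z] t.
Proof. by apply/commgP; rewrite cl3. Qed.

Let lin_r x y z t : [~ x, y, z * t] = [~ x, y, z] * [~ x, y, t].
Proof. by rewrite commgMJ (commute_conjg (central3 _ _ _ _)) central3. Qed.

Let comm2 x y z t : commute [~ x, y] [~ z, t].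
Proof.
(* [[~ x, y] ^ w] differs from [[~ x, y]] by a central factor. The choice [w = t * z] works because
   [t * z * [~ z, t] = z * t], and [z * t] and [t * z] conjugate [[~ x, y]] alike. *)
have fixzt w : ([~ x, y] ^ w) ^ [~ z, t] = [~ x, y] ^ w -> [~ x, y] ^ [~ z, t] = [~ x, y].
  rewrite (conjg_mulR _ w) conjMg (commute_conjg (central3 _ _ _ _)).
  exact: mulIg.
apply/conjg_commute/(fixzt (t * z)); rewrite -conjgM -commgC.
by rewrite !(conjg_mulR [~ x, y]) !lin_r central3.
Qed.

Let lin_m x y z t : [~ x, y * z, t] = [~ x, z, t] * [~ x, y, t].
Proof.
by rewrite commgMR commMgJ cl3 mulg1 commMgJ conjMg !(commute_conjg (central3 _ _ _ _)).
Qed.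

Let good n a := [/\ tau a = 1, tau a^-1 = 1 & tau (a * n) = 1].

Let F n a := [~ n, a^-1] * [~ f a, (f (f n))^-1].

Let goodF n a : good n a -> F n a = (tau n)^-1.
Proof.
case=> ta ta' tan; have [cfa _] := splitting_norm_comm ta ta'.
have := splitting_norm_mul ta ta' tan; rewrite cfa conjg_mulR.
rewrite -(mulgA (f a * _)) -(mulgA (f a)) => /mulgI E.
have {}E : [~ f a, (f (f n))^-1] * tau n = a * (a ^ n)^-1.
  by apply: (mulIg (a ^ n)); rewrite mulgKV -mulgA E.
apply: (mulIg (tau n)); rewrite mulVg /F -(mulgA [~ n, _]) E.
by rewrite commgEl !conjgE !invMg !invgK !mulgA !(mulgK, mulgKV) mulVg.
Qed.

(** This is the defect of multiplicativity of [F n], namely [F n (a * b) = F n a * F n b * g n a b].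
    As [F n] takes the value [(tau n)^-1] at all good points, the defect there is [tau n]. *)
Let g n a b := [~ n, b^-1, a^-1] * [~ f a, (f (f n))^-1, f b].

Let goodg n a b : good n a -> good n b -> good n (a * b) -> g n a b = tau n.
Proof.
move=> /goodF Fa /goodF Fb /goodF Fab.
have : F n (a * b) = F n a * F n b * g n a b.
  rewrite /F /g invMg fM commgMJ commMgJ conjg_mulR (conjg_mulR _ (f b)).
  move: (central3 n b^-1 a^-1) (central3 (f a) (f (f n))^-1 (f b)).
  move: (comm2 (f a) (f (f n))^-1 n b^-1).
  move: [~ n, a^-1] [~ n, b^-1] [~ n, b^-1, a^-1] => A1 B1 C.
  move: [~ f b, _] [~ f a, _] [~ f a, _, f b] => B2 A2 E A2B1 cC cE.
  rewrite -!mulgA; congr (_ * _); rewrite [RHS]mulgA A2B1 -!mulgA; congr (_ * _).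
  by rewrite (cC (A2 * _)) -!mulgA; congr (_ * _); rewrite [LHS]cE -!mulgA.
rewrite Fab Fa Fb -{1}[(tau n)^-1]mulg1 -mulgA => /mulgI/eqP.
by rewrite eq_sym -eq_invg_mul invgK => /eqP <-.
Qed.

Lemma splitting_norm_class3 n a b c :
    (forall x, x \in [:: a; b; c; b * c; a * b; a * c; a * (b * c)] ->
      [/\ tau x = 1, tau x^-1 = 1 & tau (x * n) = 1]) ->
  tau n = 1.
Proof.
move=> G; have [ga gb gc gbc] : [/\ good n a, good n b, good n c & good n (b * c)].
  by split; apply: G; rewrite !inE eqxx ?orbT.
have [gab gac gabc] : [/\ good n (a * b), good n (a * c) & good n (a * (b * c))].
  by split; apply: G; rewrite !inE eqxx ?orbT.
have : g n a (b * c) = g n a b * g n a c.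
  rewrite /g invMg fM lin_m lin_r; move: (central3 n c^-1 a^-1).
  move: [~ n, _, _] [~ n, c^-1, _] [~ f a, _, _] [~ f a, _, f c] => P Q U V cQ.
  by rewrite -!mulgA; congr (_ * _); rewrite !mulgA -cQ.
by rewrite !goodg // -{1}[tau n]mulg1 => /mulgI.
Qed.
End ClassThree.
End Splitting.

(** * Proportions of tuples in a finite group *)

Section Counting.
Local Open Scope group_scope.
Variables (I : finType) (gT : finGroupType) (D : nat).
Notation T := {ffun I -> gT}.
Implicit Types (k : nat) (Q : pred T) (t : T) (i j : I).

(* The proportion of the [t] that violate [Q] is at most [k / D]. *)
Definition almost k Q := (D * #|[pred t | ~~ Q t]| <= k * #|{: T}|)%N.

Definition upd t j z : T := [ffun k => if k == j then z else t k].

Lemma updE t j z i : upd t j z i = if i == j then z else t i.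
Proof. by rewrite ffunE. Qed.

Lemma upd_neq t j z i : i != j -> upd t j z i = t i.
Proof. by rewrite updE => /negPf ->. Qed.

Definition indep (S : Type) j (u : T -> S) := forall t z, u (upd t j z) = u t.

Lemma upd_upd t j z z' : upd (upd t j z) j z' = upd t j z'.
Proof. by apply/ffunP=> i; rewrite !ffunE; case: eqP. Qed.

Lemma upd_id t j : upd t j (t j) = t.
Proof. by apply/ffunP=> i; rewrite !ffunE; case: eqP => // ->. Qed.

Lemma almost_imp k Q Q' : (forall t, Q t -> Q' t) -> almost k Q -> almost k Q'.
Proof.
move=> QQ' aQ; apply: leq_trans aQ; rewrite leq_mul2l; apply/orP; right.
by apply/subset_leq_card/fintype.subsetP=> t; rewrite !inE; apply/contra/QQ'.
Qed.

Lemma almostI k k' Q Q' : almost k Q -> almost k' Q' ->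
  almost (k + k') (fun t => Q t && Q' t).
Proof.
move=> aQ aQ'; rewrite /almost mulnDl; apply: leq_trans (leq_add aQ aQ').
rewrite -mulnDr leq_mul2l; apply/orP; right.
rewrite -cardUI; apply: leq_trans (leq_addr _ _).
by apply/subset_leq_card/fintype.subsetP=> t; rewrite !inE negb_and.
Qed.

Lemma almost_all (S : Type) k (s : seq S) (Q : S -> pred T) :
    (forall x, almost k (Q x)) ->
  almost (k * size s) (fun t => all (fun x => Q x t) s).
Proof.
move=> aQ; elim: s => [|x s IHs] /=; last by rewrite mulnS; apply: almostI.
by rewrite /almost muln0 mul0n (eq_card0 (fun t => _)) ?muln0.
Qed.

Lemma almost_exists k Q : almost k Q -> (k < D)%N -> exists t, Q t.
Proof.
move=> aQ kD; apply/existsP; apply: contraLR aQ => /existsPn Q0.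
rewrite -ltnNge (@eq_card _ [pred t | ~~ Q t] {: T}) => [|t]; last by rewrite inE /= Q0.
rewrite ltn_pmul2r //; apply/card_gt0P; exists [ffun=> 1]; exact: isT.
Qed.

Lemma almost_inj k Q (h : T -> T) : injective h -> almost k Q ->
  almost k (fun t => Q (h t)).
Proof.
move=> h_inj; apply: leq_trans; rewrite leq_mul2l; apply/orP; right.
rewrite -(fintype.card_image h_inj).
apply/subset_leq_card/fintype.subsetP=> _ /fintype.imageP[t Qt ->].
by rewrite inE in Qt *.
Qed.

(** Multiplying the coordinate [j] on both sides by factors that ignore it permutes the tuples. *)
Lemma almost_subst k Q j (u v : T -> gT) : indep j u -> indep j v -> almost k Q ->
  almost k (fun t => Q (upd t j (u t * t j * v t))).
Proof.
move=> ju jv; apply: almost_inj.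
apply: can_inj (fun t => upd t j ((u t)^-1 * t j * (v t)^-1)) _ => t.
by rewrite upd_upd ju jv updE eqxx !mulgA mulVg mul1g mulgK upd_id.
Qed.

Lemma almost_coord (A : {pred gT}) i : (D * #|[predC A]| <= #|gT|)%N ->
  almost 1 (fun t => t i \in A).
Proof.
move=> hA; rewrite /almost mul1n.
have cardF (F : I -> pred gT) : #|(family F : simpl_pred T)| = (\prod_e #|F e|)%N.
  by rewrite card_family foldrE big_map big_enum.
pose F e := if e == i then [predC A] else predT.
rewrite (@eq_card _ [pred t : T | _] (family F)); last first.
  move=> t; rewrite !inE; apply/idP/familyP => [tA e|/(_ i)]; last by rewrite /F eqxx.
  by rewrite /F; case: (e =P i) => [->|].
rewrite (@eq_card _ {: T} (family (fun=> predT))); last first.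
  by move=> t; apply/esym/familyP.
rewrite !cardF (bigD1 i) //= [X in (_ <= X)%N](bigD1 i) //= mulnA /F eqxx leq_mul //.
by apply: leq_prod => e /negPf ->.
Qed.

Lemma almost_mem (A : {pred gT}) i (u v : T -> gT) : (D * #|[predC A]| <= #|gT|)%N ->
  indep i u -> indep i v -> almost 1 (fun t => u t * t i * v t \in A).
Proof.
move=> hA iu iv; have := almost_subst iu iv (almost_coord i hA).
by apply: almost_imp => t; rewrite updE eqxx.
Qed.

(* When [H t] is proper, right translation of the coordinate [j] by an element
outside [H t] maps the part of the fibre inside [H t] into the part outside it,
which is thus at least half of the fibre. *)
Lemma almost_subgroup k j (H : T -> {group gT}) : indep j H ->
  almost k (fun t => t j \in H t) -> almost (2 * k) (fun t => H t == [set: gT]%G).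
Proof.
move=> jH aH; rewrite /almost -mulnA; apply: leq_trans (leq_mul (leqnn 2) aH).
rewrite mulnCA leq_mul2l; apply/orP; right.
pose x t := odflt 1 [pick x | x \notin H t].
have xP t : H t != [set: gT]%G -> x t \notin H t.
  rewrite /x; case: pickP => [//|H1]; case/eqP; apply/val_inj/setP=> y /=.
  by rewrite inE; apply/negbFE/H1.
have jx : indep j x by move=> t z; rewrite /x jH.
pose B := [pred t : T | t j \notin H t].
rewrite -(cardID B) mul2n -addnn leq_add //.
  by apply/subset_leq_card/fintype.subsetP=> t; rewrite !inE => /andP[].
pose h t := upd t j (1 * t j * x t).
have h_inj : injective h.
  apply: can_inj (fun t => upd t j (t j * (x t)^-1)) _ => t.
  by rewrite /h upd_upd jx updE eqxx mul1g mulgK upd_id.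
rewrite -(fintype.card_image h_inj).
apply/subset_leq_card/fintype.subsetP=> _ /fintype.imageP[t + ->].
rewrite !inE negbK => /andP[tH /xP xH]; rewrite /h jH updE eqxx mul1g.
by rewrite groupMl.
Qed.

Lemma almost_const k (b : bool) : almost k (fun=> b) -> (k < D)%N -> b.
Proof. by move=> /almost_exists/[apply] -[]. Qed.
End Counting.

(** * Centralizers modulo the upper central series *)

Section CentralizerModulo.
Local Open Scope group_scope.
Variables (gT : finGroupType) (n : nat) (x : gT).

(** Since this is a subgroup, [almost_subgroup] applies: once it is the whole group, [x] lies in the
    next term of the upper central series. *)
Definition cent_mod := [set y | [~ x, y] \in 'Z_n([set: gT])].

Lemma cent_mod_group_set : group_set cent_mod.
Proof.
have Zn y z : y \in 'Z_n([set: gT]) -> y ^ z \in 'Z_n([set: gT]).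
  by move=> yZ; rewrite memJ_norm // (fintype.subsetP (normal_norm (ucn_normal _ _))) ?inE.
apply/group_setP; split=> [|y z]; rewrite !inE ?commg1 ?group1 //.
by move=> yZ zZ; rewrite commgMJ groupM ?Zn.
Qed.

Canonical cent_mod_group := Group cent_mod_group_set.

Lemma cent_mod_setT : cent_mod = [set: gT] -> x \in 'Z_n.+1([set: gT]).
Proof.
move=> xZ; rewrite ucnSnR inE finset.in_setT gen_subG.
by apply/fintype.subsetP=> _ /imset2P[_ y /set1P-> _ ->]; have := finset.in_setT y; rewrite -xZ inE.
Qed.
End CentralizerModulo.

(** * Finite groups whose norm is trivial almost everywhere *)

Section Finite.
Local Open Scope group_scope.
Variables (gT : finGroupType) (f : gT -> gT) (D : nat).
Hypotheses (fM : {morph f : x y / x * y}) (f3 : forall x, f (f (f x)) = x).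
Notation tau := (splitting_norm f).
Hypotheses (D_large : (16 * 608 < D)%N)
  (tauD : (D * #|[pred a | tau a != 1%g]| <= #|gT|)%N).

Notation T := {ffun 'I_4 -> gT}.
Notation almost := (@almost _ gT D).
Implicit Types (i j k l : 'I_4) (t : T).

Lemma almost_tau i (u v : T -> gT) : indep i u -> indep i v ->
  almost 1 (fun t => tau (u t * t i * v t) == 1).
Proof. exact: (@almost_mem _ _ _ [pred a | tau a == 1]). Qed.

Lemma almost_tauV i (u v : T -> gT) : indep i u -> indep i v ->
  almost 1 (fun t => tau (u t * t i * v t)^-1 == 1).
Proof.
apply: (@almost_mem _ _ _ [pred a | tau a^-1 == 1]); apply: leq_trans tauD.
rewrite leq_mul2l; apply/orP; right.
rewrite -(fintype.card_image (@invg_inj gT)).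
apply/subset_leq_card/fintype.subsetP=> _ /fintype.imageP[x + ->].
by rewrite !inE.
Qed.

Lemma almost_engel i j : i != j -> almost 8 (fun t => engel (t i) (t j)).
Proof.
move=> ij; have ji : j != i by rewrite eq_sym.
pose c1 := fun _ : T => 1 : gT.
have i1 e : indep e c1 by [].
have iv (h : gT -> gT) : indep i (fun t => h (t j)) by move=> t z; rewrite upd_neq.
have := almostI (almost_tau (i1 i) (i1 i)) (almostI (almost_tauV (i1 i) (i1 i))
  (almostI (almost_tau (i1 j) (i1 j)) (almostI (almost_tauV (i1 j) (i1 j))
  (almostI (almost_tau (i1 i) (iv (fun x => f (f x))))
  (almostI (almost_tauV (iv (fun x => (f (f x))^-1)) (i1 i))
  (almostI (almost_tau (i1 i) (iv (fun x => x^-1))) (almost_tauV (iv id) (i1 i)))))))).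
apply: almost_imp => t; rewrite /c1 !mul1g !mulg1 !invMg invgK.
case/and5P=> /eqP t1 /eqP t2 /eqP t3 /eqP t4 /and4P[/eqP t5 /eqP t6 /eqP t7 /eqP t8].
exact: (splitting_engel fM f3).
Qed.

Lemma almost_engelr i j (u v : T -> gT) : i != j -> indep j u -> indep j v ->
  almost 8 (fun t => engel (t i) (u t * t j * v t)).
Proof.
move=> ij ju jv; have := almost_subst ju jv (almost_engel ij).
by apply: almost_imp => t; rewrite upd_neq // updE eqxx.
Qed.

Lemma almost_engell i j (u v : T -> gT) : i != j -> indep i u -> indep i v ->
  almost 8 (fun t => engel (u t * t i * v t) (t j)).
Proof.
move=> ij ju jv; have := almost_subst ju jv (almost_engel ij).
by apply: almost_imp => t; rewrite updE eqxx upd_neq // eq_sym.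
Qed.

(** Seven Engel conditions of weight 8; each follows from [almost_engel], if necessary by
    substitution in a coordinate that it mentions only once. *)
Lemma almost_tri i j k : i != j -> i != k -> j != k ->
  almost 56 (fun t => tri_generic (t i) (t j) (t k)).
Proof.
move=> ij ik jk.
have [ji ki kj] : [/\ j != i, k != i & k != j] by rewrite ![_ == i]eq_sym (eq_sym k).
have ind e e' (h : gT -> gT) : e != e' -> indep e' (fun t => h (t e)).
  by move=> ee' t z; rewrite upd_neq.
apply: (@almostI _ _ _ 8 48); first exact: almost_engel.
apply: (@almostI _ _ _ 8 40); first exact: almost_engel.
apply: (@almostI _ _ _ 8 32).
  have := almost_engell ki (ind j k invg jk) (ind j k (fun=> 1) jk).
  by apply: almost_imp => t; rewrite mulg1.
apply: (@almostI _ _ _ 8 24); first exact: almost_engel.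
apply: (@almostI _ _ _ 8 16).
  have := almost_engelr kj (ind i j id ij) (ind i j (fun=> 1) ij).
  by apply: almost_imp => t; rewrite mulg1.
apply: (@almostI _ _ _ 8 8).
  have := almost_engelr kj (ind i j (fun=> 1) ij) (ind i j invg ij).
  by apply: almost_imp => t; rewrite mul1g.
exact: almost_engelr kj (ind i j id ij) (ind i j invg ij).
Qed.

Lemma almost_quad i j k l : i != l -> j != l -> k != l ->
  almost 128 (fun t => quad_generic (t i) (t j) (t k) (t l)).
Proof.
move=> il jl kl.
pose w e t := [:: 1; t j; t k; t j * t k]`_e.
have indw e : indep l (w e) by move=> t z; rewrite /w !upd_neq.
have indwV e : indep l (fun t => (w e t)^-1) by move=> t z; rewrite indw.
have := almost_all (iota 0 4) (fun e => almost_all (iota 0 4)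
  (fun e' => almost_engelr il (indw e) (indwV e'))).
exact: almost_imp.
Qed.

Let i0 : 'I_4 := @Ordinal 4 0 isT.
Let i1 : 'I_4 := @Ordinal 4 1 isT.
Let i2 : 'I_4 := @Ordinal 4 2 isT.
Let i3 : 'I_4 := @Ordinal 4 3 isT.

Lemma almost_comm4 : almost 608 (fun t => [~ t i0, t i1, t i2, t i3] == 1).
Proof.
have ind0 e : indep e (fun _ : T => 1 : gT) by [].
have ind1 : indep i3 (fun t => (t i1)^-1) by move=> t z; rewrite upd_neq.
have ind2 : indep i1 (fun t => [~ t i2, t i3]^-1) by move=> t z; rewrite !upd_neq.
have ind3 : indep i3 (fun t => [~ t i0, t i1]^-1) by move=> t z; rewrite !upd_neq.
(* Six triples of weight 56, two quadruples of weight 128 and two Engel conditions of weight 8 add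
   up to 608. *)
have := almostI (@almost_tri i0 i1 i2 isT isT isT) (almostI (@almost_tri i1 i2 i0 isT isT isT)
  (almostI (@almost_tri i2 i0 i1 isT isT isT) (almostI (@almost_tri i2 i0 i3 isT isT isT)
  (almostI (almost_subst ind1 (ind0 i3) (@almost_tri i2 i0 i3 isT isT isT))
  (almostI (@almost_tri i3 i0 i2 isT isT isT)
  (almostI (@almost_quad i0 i1 i2 i3 isT isT isT)
  (almostI (@almost_quad i2 i3 i0 i1 isT isT isT)
  (almostI (@almost_engell i1 i0 _ _ isT ind2 (ind0 i1))
           (@almost_engell i3 i2 _ _ isT ind3 (ind0 i3)))))))))).
apply: almost_imp => t; case/and5P=> T1 T2 T3 T4.
rewrite !updE !mulg1 /= => /and5P[T5 T6 Q1 Q2 /andP[e1 e2]].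
apply/eqP/commg4_eq1 => //.
  (* The Engel condition was obtained for the inverse element, in which the substituted coordinate
     occurs uninverted. *)
  by rewrite -engelV invMg invgK.
by rewrite -engelV invMg invgK.
Qed.

Lemma splitting_class3 (x y z t : gT) : [~ x, y, z, t] = 1.
Proof.
pose H1 (t : T) := cent_mod_group 0 [~ t i0, t i1, t i2].
pose H2 (t : T) := cent_mod_group 1 [~ t i0, t i1].
pose H3 (t : T) := cent_mod_group 2 (t i0).
(* The coordinates are eliminated from last to first, raising the upper central term by one and
   doubling the weight each time; the fourth doubling gives [16 * 608], still below [D]. *)
have A1 : almost 608 (fun t => t i3 \in H1 t).
  by apply: almost_imp almost_comm4 => u; rewrite inE ucn0 inE.
have A2 : almost 1216 (fun t => t i2 \in H2 t).
  apply: almost_imp (almost_subgroup _ A1) => [u /eqP/(congr1 val)/cent_mod_setT|].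
    by move=> uZ; rewrite inE.
  by move=> u w; rewrite /H1 !upd_neq.
have A3 : almost 2432 (fun t => t i1 \in H3 t).
  apply: almost_imp (almost_subgroup _ A2) => [u /eqP/(congr1 val)/cent_mod_setT|].
    by move=> uZ; rewrite inE.
  by move=> u w; rewrite /H2 !upd_neq.
have A4 : almost 4864 (fun t => t i0 \in [group of 'Z_3([set: gT])]).
  apply: almost_imp (almost_subgroup _ A3) => [u /eqP/(congr1 val)/cent_mod_setT|] //.
  by move=> u w; rewrite /H3 !upd_neq.
have := @almost_subgroup _ _ _ _ _ (fun=> [group of 'Z_3([set: gT])]) (fun _ _ => erefl) A4.
move=> /almost_const/(_ D_large)/eqP/(congr1 val) /= Z3.
have /eqP L4 : 'L_4([set: gT]) == 1 by rewrite ucn_lcnP Z3.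
suff: [~ x, y, z, t] \in 'L_4([set: gT]) by rewrite L4 => /set1P.
by do !apply: mem_commg; rewrite ?inE.
Qed.

Theorem splitting_norm1 n : tau n = 1.
Proof.
have ind0 e : indep e (fun _ : T => 1 : gT) by [].
have indn e : indep e (fun _ : T => n) by [].
pose ok x := [&& tau x == 1, tau x^-1 == 1 & tau (x * n) == 1].
have ok3 (i : 'I_4) (u : T -> gT) : indep i u -> almost 3 (fun t => ok (u t * t i)).
  move=> iu; have := almostI (almost_tau iu (ind0 i))
    (almostI (almost_tauV iu (ind0 i)) (almost_tau iu (indn i))).
  by apply: almost_imp => t; rewrite !mulg1.
have i10 : indep i1 (fun t => t i0) by move=> t z; rewrite upd_neq.
have i21 : indep i2 (fun t => t i1) by move=> t z; rewrite upd_neq.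
have i20 : indep i2 (fun t => t i0) by move=> t z; rewrite upd_neq.
have i201 : indep i2 (fun t => t i0 * t i1) by move=> t z; rewrite !upd_neq.
(* Seven words with three conditions each have total weight 21; every word is a left translate of
   its last coordinate. *)
have := almostI (ok3 i0 _ (ind0 _)) (almostI (ok3 i1 _ (ind0 _))
  (almostI (ok3 i2 _ (ind0 _)) (almostI (ok3 i2 _ i21) (almostI (ok3 i1 _ i10)
  (almostI (ok3 i2 _ i20) (ok3 i2 _ i201)))))).
case/almost_exists => [|t]; first exact: leq_trans D_large.
rewrite !mul1g -mulgA => allok.
apply: (splitting_norm_class3 fM splitting_class3 (a := t i0) (b := t i1) (c := t i2)).
have {}allok : all ok [:: t i0; t i1; t i2; t i1 * t i2; t i0 * t i1; t i0 * t i2;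
    t i0 * (t i1 * t i2)] by rewrite /= andbT.
by move=> x /(allP allok)/and3P[/eqP-> /eqP-> /eqP->].
Qed.
End Finite.

(** * From the norm to cubes in a coset of a finite group *)

Section CubicCoset.
Local Open Scope group_scope.

(* Quadruples fail to satisfy [[a,b,c,d] = 1] with probability at most [608 / D],
and each of the four applications of [almost_subgroup] costs a factor 2. *)
Definition cubic_threshold := (16 * 608).+1.

Theorem cubic_coset (gT : finGroupType) (N : {group gT}) (y : gT) :
    y \in 'N(N) -> y ^+ 3 = 1 ->
    (cubic_threshold * #|[set a in N | (y * a) ^+ 3 != 1%g]| <= #|N|)%N ->
  {in N, forall a, (y * a) ^+ 3 = 1}.
Proof.
move=> yN y3 small a aN.
pose f (u : subg_of N) := subg N (sgval u ^ y).
have fval u : sgval (f u) = sgval u ^ y by rewrite subgK // memJ_norm ?subgP.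
have fM : {morph f : u v / u * v}.
  by move=> u v; apply: val_inj => /=; rewrite !(fval, morphM) ?inE //= conjMg -!fval.
have yy : y * y = y^-1 by apply/eqP; rewrite eq_sym eq_invg_mul -expg2 -expgS y3.
have f3 u : f (f (f u)) = u.
  by apply: val_inj => /=; rewrite !fval -!conjgM yy ?mulVg ?mulgV conjg1.
(* As [y * y = y^-1], the second iterate of [f] sends [u] to [y * u * y^-1], and the inner factor
   [y^-1 * y^-1] becomes [y]. *)
have tauE u : sgval (splitting_norm f u) = (y * sgval u) ^+ 3.
  rewrite /splitting_norm /= !fval -conjgM yy expgS expg2.
  have yy' : y^-1 * y^-1 = y by rewrite -invMg yy invgK.
  by rewrite !conjgE !invgK !mulgA -(mulgA (y * _) y^-1) yy'.
have := @splitting_norm1 _ f cubic_threshold fM f3 (leqnn _).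
have -> : #|subg_of N| = #|N| by rewrite card_sub.
move=> H; rewrite -[a in LHS](@subgK _ N) // -tauE H //.
apply: leq_trans small; rewrite leq_mul2l; apply/orP; right.
rewrite -(fintype.card_image (@subg_inj _ N)).
apply/subset_leq_card/fintype.subsetP=> _ /fintype.imageP[u + ->].
by rewrite !inE subgP -tauE.
Qed.
End CubicCoset.

Local Open Scope classical_set_scope.

(** * Clopen sets in compact Hausdorff spaces *)

Section ZeroDimensional.
Variable T : ptopologicalType.
Hypotheses (cptT : compact [set: T]) (hsdT : hausdorff_space T).

(** The complement of [O] is compact, so the complements of finitely many separating clopen sets
    cover it; the intersection of these sets is [W]. *)
Lemma clopen_sub_open (x : T) (O : set T) : open O ->
    (forall y, ~ O y -> exists C, [/\ clopen C, C x & ~ C y]) ->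
  exists W, [/\ clopen W, W x & W `<=` O].
Proof.
move=> oO sep; have : compact (~` O).
  by apply: subclosed_compact cptT _ => //; exact: open_closedC.
rewrite compact_cover => /(_ (set T) [set C | clopen C /\ C x] (fun C => ~` C)).
case=> [C [[_ cC] _]|y /sep[C [? ? ?]]|F FD cov]; [exact: closed_openC|by exists C|].
exists (\big[setI/setT]_(C <- F) C).
have clF : clopen (\big[setI/setT]_(C <- F) C) /\ (\big[setI/setT]_(C <- F) C) x.
  rewrite big_seq; apply: (big_ind (fun W => clopen W /\ W x)).
  - by split=> //; exact: clopenT.
  - by move=> A B [? ?] [? ?]; split=> //; exact: clopenI.
  - by move=> C /FD; rewrite inE.
case: clF => clF xF; split=> // y Fy; apply: contrapT => /cov[C CF]; apply.
by move: Fy; rewrite -bigcap_seq; apply.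
Qed.

(* In a compact Hausdorff space, the intersection of the clopen sets containing
a point is connected. *)
Lemma totally_disconnected_zero_dimensional :
  totally_disconnected [set: T] -> zero_dimensional T.
Proof.
move=> tdT x y xy.
pose Q := [set z | forall C, clopen C -> C x -> C z].
have Qx : Q x by [].
have cQ : closed Q.
  have -> : Q = \bigcap_(C in [set C | clopen C /\ C x]) C.
    by apply/seteqP; split=> z Qz C; [case=> ? ?|move=> ? ?]; apply: Qz.
  by apply: closed_bigI => C [[]].
have conQ : connected Q.
  move=> B [b Bb] [E oE BE] [C cC BC].
  have cB : closed B by rewrite BC; exact: closedI.
  have cQB : closed (Q `\` B).
    have -> : Q `\` B = Q `&` ~` E.
      by rewrite BE setDIr setDv set0U.
    by apply: closedI => //; exact: open_closedC.
  have : set_nbhs B (~` (Q `\` B)).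
    apply/set_nbhsP; exists (~` (Q `\` B)); split=> //; first exact: closed_openC.
    by move=> z Bz [].
  move=> /(compact_normal hsdT cptT cB)[V /set_nbhsP[U [oU BU UV]] VQB].
  (* A point of [closure V] outside [U] is not in [Q], since [closure V] avoids the rest of [Q]
     beyond [B], and [B] lies in [U]. Hence some clopen set separates it from [x]. *)
  have [W [[oW cW] Wx WUV]] : exists W, [/\ clopen W, W x & W `<=` U `|` ~` closure V].
    apply: clopen_sub_open => [|z].
      by apply: openU => //; exact/closed_openC/closed_closure.
    move=> /not_orP[nUz /contrapT Vz]; apply: contrapT => nC.
    have Qz : Q z by move=> C' clC' C'x; apply: contrapT => C'z; apply: nC; exists C'.
    by apply: nUz; apply: BU; apply: contrapT => nBz; apply: (VQB _ Vz).
  have UclV : U `<=` closure V by apply: subset_trans UV _; exact: subset_closure.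
  have clWU : clopen (W `&` U).
    split; first exact: openI.
    have -> : W `&` U = W `&` closure V.
      apply/seteqP; split=> z [Wz Uz]; split=> //; first exact: UclV.
      by case: (WUV _ Wz).
    by apply: closedI => //; exact: closed_closure.
  apply/seteqP; split=> [z|z Qz]; first by rewrite BE => -[].
  (* If [x] is in [U], the clopen set formed by [W] and [U] contains [Q], which forces [Q] into [B].
     Otherwise [Q] avoids this set, although [b] lies in both. *)
  have [Ux|nUx] := pselect (U x).
    have [_ Uz] := Qz _ clWU (conj Wx Ux).
    by apply: contrapT => nBz; apply: (VQB z) => //; exact: UclV.
  have Qb : Q b by move: Bb; rewrite BE => -[].
  have [] := Qb _ (clopenI (conj oW cW) (clopenC set0 clWU)).
    by split=> // -[].
  by move=> Wb []; split=> //; exact: BU.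
have := connected_component_max Qx (@subsetT _ Q) conQ; rewrite (tdT x) // => Q1.
apply: contrapT => nC; move/eqP: xy; apply; apply/esym/Q1 => C clC Cx.
by apply: contrapT => Cy; apply: nC; exists C.
Qed.
End ZeroDimensional.

(** * Open subgroups and finite quotients of a profinite group *)

Section ProfiniteGroup.
Variables (G : ptopologicalType) (mul : G -> G -> G) (inv : G -> G) (one : G).
Hypothesis profG : is_profinite_group mul inv one.
Implicit Types g h x y : G.

Let grpG : is_group mul inv one. Proof. by case: profG => -[]. Qed.
Let mulA x y z : mul x (mul y z) = mul (mul x y) z. Proof. by case: grpG. Qed.
Let mul1 x : mul one x = x. Proof. by case: grpG. Qed.
Let mulr1 x : mul x one = x. Proof. by case: grpG. Qed.
Let mulV x : mul (inv x) x = one. Proof. by case: grpG. Qed.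
Let mulrV x : mul x (inv x) = one. Proof. by case: grpG. Qed.
Let mulK x y : mul (inv x) (mul x y) = y. Proof. by rewrite mulA mulV mul1. Qed.
Let mulKV x y : mul x (mul (inv x) y) = y. Proof. by rewrite mulA mulrV mul1. Qed.
Let invE x y : mul x y = one -> inv x = y.
Proof. by move=> xy; rewrite -(mulK x y) xy mulr1. Qed.
Let invK x : inv (inv x) = x. Proof. exact: invE. Qed.
Let invM x y : inv (mul x y) = mul (inv y) (inv x).
Proof. by apply: invE; rewrite -mulA mulKV. Qed.
Let inv1 : inv one = one. Proof. exact: invE. Qed.

Let mul_cts : continuous (fun p : G * G => mul p.1 p.2). Proof. by case: profG => -[]. Qed.
Let inv_cts : continuous inv. Proof. by case: profG => -[]. Qed.
Let cptG : compact [set: G]. Proof. by case: profG. Qed.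
Let hsdG : hausdorff_space G. Proof. by case: profG. Qed.

Lemma mul_continuous (T : topologicalType) (u v : T -> G) :
  continuous u -> continuous v -> continuous (fun t => mul (u t) (v t)).
Proof.
move=> cu cv t; apply: (@continuous2_cvg _ _ _ _ (nbhs t) _ u v mul) => //.
- exact: (@mul_cts (u t, v t)).
- exact: cu.
- exact: cv.
Qed.

Definition subgroup (H : set G) :=
  [/\ H one, forall x y, H x -> H y -> H (mul x y) & forall x, H x -> H (inv x)].

(** For a clopen [U] in [V] around [one], the elements translating [U] into itself form a monoid,
    open by compactness of [U]. Those whose inverse also belongs to it form the subgroup, which lies
    in [U] because it moves [one] into [U]. *)
Lemma open_subgroup_sub (V : set G) : nbhs one V ->
  exists H, [/\ subgroup H, open H & H `<=` V].
Proof.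
move=> V1; have tdG : totally_disconnected [set: G] by case: profG.
have zdG := totally_disconnected_zero_dimensional cptG hsdG tdG.
have [U [U1 [oU cU]] UV] := zero_dimensional_cvg hsdG zdG cptG V1.
pose K := [set g | U `<=` [set u | U (mul g u)]].
have oK : open K.
  rewrite openE => g Kg.
  have /compact_near_coveringP cptU : compact U by apply: subclosed_compact cptG _.
  apply: (cptU G (nbhs g) (fun h u => U (mul h u))) => u Uu.
  have /(_ (u, g) U) : continuous (fun p : G * G => mul p.2 p.1).
    by apply: mul_continuous => p; [exact: cvg_snd|exact: cvg_fst].
  by apply; apply: open_nbhs_nbhs; split=> //; apply: Kg.
exists (K `&` inv @^-1` K); split.
- split=> [|x y [Kx Kx'] [Ky Ky']|x [Kx Kx']]; last by split; rewrite //= invK.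
    by split=> u Uu /=; rewrite ?inv1 mul1.
  split=> u Uu /=; first by rewrite -mulA; apply/Kx/Ky.
  by rewrite invM -mulA; apply/Ky'/Kx'.
- by apply: openI => //; apply: open_comp => // ? _; exact: inv_cts.
- by move=> x [Kx _]; apply: UV; rewrite -(mulr1 x); apply: Kx.
Qed.

Lemma subgroup_lcoset_open (H : set G) g : open H ->
  open [set x | H (mul (inv g) x)].
Proof.
move=> oH; have /continuousP : continuous (fun x => mul (inv g) x); last exact.
by apply: mul_continuous => x; [exact: cvg_cst|exact: cvg_id].
Qed.

Definition finite_quotient (Q : finGroupType) (r : G -> Q) :=
  (forall x y, r (mul x y) = (r x * r y)%g) /\ open (r @^-1` [set 1%g]).

(* [G] acts on the finitely many left cosets of an open subgroup [H], each
represented by a chosen element. *)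
Lemma finite_quotient_sub (V : set G) : nbhs one V ->
  exists (Q : finGroupType) (r : G -> Q),
    finite_quotient r /\ r @^-1` [set 1%g] `<=` V.
Proof.
move=> /open_subgroup_sub[H [[H1 HM HV] oH HV']].
(* The set is the coset of [g], which contains [g], so [get] never returns its default, and the
   choice depends on the coset only. *)
pose c g : G := get [set x | H (mul (inv g) x)].
have cP g : H (mul (inv g) (c g)).
  by apply: (@getI _ [set x | H (mul (inv g) x)] g); rewrite /= mulV.
have c_eq g h : H (mul (inv g) h) -> c g = c h.
  move=> gh; congr get; apply/seteqP; split=> x /= Hx.
    rewrite -(mulKV g x) mulA; apply: HM => //.
    by rewrite -[mul (inv h) g]invK invM invK; apply: HV.
  by rewrite -(mulKV h x) mulA; apply: HM.
have eq_c g h : c g = c h -> H (mul (inv g) h).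
  move=> gh; rewrite -(mulKV (c g) h) mulA; apply: HM => //.
  by rewrite gh -[mul (inv (c h)) h]invK invM invK; apply: HV.
have fin_c : finite_set (range c).
  have := cptG; rewrite compact_cover.
  move=> /(_ G setT (fun g => [set x | H (mul (inv g) x)])).
  case=> [g _|x _|F _ cov].
  - exact: subgroup_lcoset_open.
  - by exists x => //=; rewrite mulV.
  apply: (@sub_finite_set _ _ (c @` [set` F])).
    by move=> _ [x _ <-]; have [g gF /c_eq gx] := cov x I; exists g.
  exact: finite_image.
pose T : finType := fset_set (range c).
have cT g : c g \in fset_set (range c) by rewrite in_fset_set // inE; exists g.
(* The inverse is there because permutations compose from left to right: it makes [r] a
   homomorphism. *)
pose act g (t : T) : T := [` cT (mul (inv g) (val t))]%fset.
have valT (t : T) : c (val t) = val t.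
  have := valP t; rewrite in_fset_set // inE => -[x _ <-].
  by apply/esym/c_eq.
have actM g h t : act (mul g h) t = act h (act g t).
  apply: val_inj => /=; apply: c_eq; rewrite !invM !invK -!mulA mulKV.
  by have := cP (mul (inv g) (val t)); rewrite invM invK -mulA.
have act1 t : act one t = t by apply: val_inj; rewrite /= inv1 mul1 valT.
have actK g : cancel (act g) (act (inv g)) by move=> t; rewrite -actM mulrV act1.
pose r g : {perm T} := perm (can_inj (actK g)).
have rM g h : r (mul g h) = (r g * r h)%g.
  by apply/permP=> t; rewrite permM !permE actM.
(* The kernel is a finite intersection of conjugates of [H], hence open. *)
have r1 g : r g = 1%g <-> forall t : T, H (mul (inv (val t)) (mul g (val t))).
  split=> [rg t|gH].
    have := congr1 (fun s : {perm T} => val (s t)) rg; rewrite permE perm1 /=.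
    by rewrite -[RHS]valT => /eq_c; rewrite invM invK -mulA.
  apply/permP=> t; rewrite permE perm1; apply: val_inj => /=; rewrite -[RHS]valT.
  by apply: c_eq; rewrite invM invK -mulA; apply: gH.
exists {perm T}, r; split.
  split=> //; rewrite openE => g /r1 gH.
  suff : \forall h \near g, forall t : T, H (mul (inv (val t)) (mul h (val t))).
    by apply: filterS => h /r1.
  apply: filter_forall => t; apply: open_nbhs_nbhs; split=> //.
  have /continuousP : continuous (fun h => mul (inv (val t)) (mul h (val t))).
    by apply: mul_continuous => [x|]; [exact: cvg_cst|];
       apply: mul_continuous => x; [exact: cvg_id|exact: cvg_cst].
  exact.
move=> g /r1 rg; have /= gH := rg [` cT one]%fset; apply: HV'.
have Hc : H (c one) by have := cP one; rewrite inv1 mul1.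
have -> : g = mul (c one) (mul (mul (inv (c one)) (mul g (c one))) (inv (c one))).
  by rewrite -!mulA mulrV mulr1 mulKV.
by apply: (HM) => //; apply: (HM) => //; apply: HV.
Qed.
End ProfiniteGroup.

Local Open Scope ring_scope.

(** * Haar measure of cosets and the solutions of the cubic equation *)

Section CubicHaar.
Variables (R : realType) (G : ptopologicalType).
Variables (mul : G -> G -> G) (inv : G -> G) (one : G).
Variable mu : {measure set (borelType G) -> \bar R}.
Hypothesis profG : is_profinite_group mul inv one.
Hypothesis haarG : is_normalized_haar mul mu.
Implicit Types (A B U : set (borelType G)) (g x y z : G).

Let grpG : is_group mul inv one. Proof. by case: profG => -[]. Qed.
Let mulA x y z : mul x (mul y z) = mul (mul x y) z. Proof. by case: grpG. Qed.
Let mul1 x : mul one x = x. Proof. by case: grpG. Qed.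
Let mulr1 x : mul x one = x. Proof. by case: grpG. Qed.
Let mulV x : mul (inv x) x = one. Proof. by case: grpG. Qed.
Let mulrV x : mul x (inv x) = one. Proof. by case: grpG. Qed.
Let mulKV x y : mul x (mul (inv x) y) = y. Proof. by rewrite mulA mulrV mul1. Qed.
Let cptG : compact [set: G]. Proof. by case: profG. Qed.
Let hsdG : hausdorff_space G. Proof. by case: profG. Qed.

Definition haar A : R := fine (mu A).

Lemma open_borel (A : set G) : open A -> measurable (A : set (borelType G)).
Proof. exact: sub_sigma_algebra. Qed.

Lemma closed_borel (A : set G) : closed A -> measurable (A : set (borelType G)).
Proof.
move=> cA; rewrite -[A]setCK; apply: measurableC; apply: open_borel.
exact: closed_openC.
Qed.

Lemma haarE A : measurable A -> mu A = (haar A)%:E.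
Proof.
move=> mA; rewrite /haar fineK // ge0_fin_numE //.
have [muT _ _ _] := haarG; apply: (@le_lt_trans _ _ (mu setT)).
  by apply: le_measure; rewrite ?inE //; exact: measurableT.
by rewrite muT ltry.
Qed.

Lemma haar_ge0 A : 0 <= haar A.
Proof. exact/fine_ge0/measure_ge0. Qed.

Lemma le_haar A B : measurable A -> measurable B -> A `<=` B -> haar A <= haar B.
Proof.
move=> mA mB AB; rewrite -lee_fin -!haarE //.
by apply: le_measure; rewrite ?inE.
Qed.

Lemma haarU A B : measurable A -> measurable B -> A `&` B = set0 ->
  haar (A `|` B) = haar A + haar B.
Proof.
move=> mA mB AB; apply: EFin_inj; rewrite EFinD -!haarE //; first exact: measureU.
exact: measurableU.
Qed.

Section Quotient.
Variables (Q : finGroupType) (r : G -> Q).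
Hypothesis fq : finite_quotient mul r.

Let rM x y : r (mul x y) = (r x * r y)%g. Proof. by case: fq. Qed.

Lemma quotient1 : r one = 1%g.
Proof. by apply: (mulgI (r one)); rewrite -rM mul1 mulg1. Qed.

Lemma quotientV x : r (inv x) = (r x)^-1%g.
Proof. by apply/esym/eqP; rewrite eq_invg_mul -rM mulrV quotient1. Qed.

Lemma quotient_fiber g : r @^-1` [set r g] = [set mul g x | x in r @^-1` [set 1%g]].
Proof.
apply/seteqP; split=> [x /= rx|_ [x /= rx <-]]; last by rewrite rM rx mulg1.
by exists (mul (inv g) x); rewrite ?mulKV //= rM quotientV rx mulVg.
Qed.

Lemma quotient_open (A : set Q) : open (r @^-1` A).
Proof.
rewrite openE => x /= Ax; apply: (@filterS _ _ _ [set y | r (mul (inv x) y) = 1%g]).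
  by move=> y /=; rewrite rM quotientV => /eqP; rewrite -eq_mulVg1 => /eqP <-.
apply: open_nbhs_nbhs; split; last by rewrite /= mulV quotient1.
by apply: (@subgroup_lcoset_open _ _ _ _ profG (r @^-1` [set 1%g])); case: fq.
Qed.

Lemma haar_fibers A (s : seq Q) : measurable A -> uniq s ->
  haar (A `&` r @^-1` [set q | q \in s]) = \sum_(q <- s) haar (A `&` r @^-1` [set q]).
Proof.
move=> mA; have mr (E : set Q) : measurable (A `&` r @^-1` E : set (borelType G)).
  by apply: measurableI => //; apply: open_borel; exact: quotient_open.
elim: s => [|q s IHs] /= => [_|/andP[qs us]].
  by rewrite big_nil (_ : _ `&` _ = set0) ?/haar ?measure0 // -subset0 => x [].
rewrite big_cons -IHs // -haarU //; last first.
  by rewrite -subset0 => x [[_ /= ->] [_ /=]]; rewrite (negPf qs).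
congr haar; apply/seteqP; split=> x /=.
  by rewrite inE => -[Ax /orP[/eqP|]]; [left|right].
by rewrite inE => -[] [Ax rx]; split=> //; apply/orP; [left; apply/eqP|right].
Qed.

(** A nonempty fibre is a left translate of the kernel. The hypothesis on [B] rules out empty
    fibres, as [r] may fail to be onto. *)
Lemma haar_quotient (B : {set Q}) : (forall q, q \in B -> exists g, r g = q) ->
  haar (r @^-1` [set q | q \in B]) = #|B|%:R * haar (r @^-1` [set 1%g]).
Proof.
move=> rB; have := @haar_fibers setT (enum B) measurableT (enum_uniq _).
have -> : [set q | q \in enum B] = [set q | q \in B].
  by apply/seteqP; split=> q /=; rewrite mem_enum.
rewrite setTI => ->; rewrite big_enum /= (eq_bigr (fun=> haar (r @^-1` [set 1%g]))).
  by rewrite sumr_const mulr_natl.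
move=> _ /rB[g <-]; rewrite setTI quotient_fiber /haar; congr fine.
by have [_ + _ _] := haarG; apply; apply: open_borel; exact: quotient_open.
Qed.
End Quotient.

Notation X := [set x : G | mul x (mul x x) = one].

Lemma cubic_closed : closed X.
Proof.
have cc : continuous (fun x => mul x (mul x x)).
  by do 2?[apply: (mul_continuous profG)] => x; exact: cvg_id.
apply: (closed_comp (f := fun x => mul x (mul x x)) (D := [set one])) => [? _|].
  exact: cc.
exact/accessible_closed_set1/hausdorff_accessible.
Qed.

Lemma haarD A : measurable A -> haar (A `\` X) = haar A - haar (A `&` X).
Proof.
move=> mA; have mX := closed_borel cubic_closed.
have : haar ((A `&` X) `|` (A `\` X)) = haar (A `&` X) + haar (A `\` X).
  apply: haarU; [exact: measurableI|exact: measurableD|].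
  by rewrite -subset0 => x [[_ Xx] [_]].
by rewrite setUIDK => ->; rewrite addrAC subrr add0r.
Qed.

Lemma cubic_dense_coset (D : nat) : (0 < mu X)%E -> (0 < D)%N ->
  exists (Q : finGroupType) (r : G -> Q) (q : Q), finite_quotient mul r /\
    D%:R * haar (r @^-1` [set q] `\` X) < haar (r @^-1` [set q]).
Proof.
have mX := closed_borel cubic_closed; rewrite haarE // lte_fin => X0 D0.
have [U [oU XU] UX] : exists2 U, open U /\ X `<=` U & haar U < haar X + haar X / D%:R.
  have [_ _ _ /(_ _ mX) muX] := haarG.
  have : (mu X < (haar X + haar X / D%:R)%:E)%E.
    by rewrite haarE // lte_fin ltrDl divr_gt0 // ltr0n.
  rewrite {1}muX => /ereal_inf_lt[_ [U [oU XU] <-]] UX; exists U => //.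
  by rewrite -lte_fin -haarE //; exact: open_borel.
have mU := open_borel oU.
(* Compactness of [X] gives one neighbourhood of [one] that works for all [x] in [X]; thus every
   coset of the kernel that meets [X] lies in [U]. *)
have /(finite_quotient_sub profG)[Q [r [fq rU]]] : nbhs one [set g | X `<=` [set x | U (mul x g)]].
  have /compact_near_coveringP cptX : compact X.
    by apply: subclosed_compact cptG _ => //; exact: cubic_closed.
  apply: (cptX G (nbhs one) (fun g x => U (mul x g))) => x Xx.
  have /(_ (x, one) U) : continuous (fun p : G * G => mul p.1 p.2) by case: profG => -[].
  by apply; apply: open_nbhs_nbhs; split=> //=; rewrite mulr1; apply: XU.
exists Q, r; apply: contrapT => nq.
pose s := [seq q <- enum Q | `[< exists2 x, X x & r x = q >]].
have us : uniq s by rewrite filter_uniq ?enum_uniq.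
pose U0 := r @^-1` [set q | q \in s].
have mU0 : measurable (U0 : set (borelType G)) by apply: open_borel; exact: quotient_open fq _.
have XU0 : X `<=` U0.
  by move=> x Xx; rewrite /U0 /= mem_filter mem_enum andbT; apply/asboolP; exists x.
have U0U : U0 `<=` U.
  move=> y; rewrite /U0 /= mem_filter => /andP[/asboolP[x Xx rx] _].
  rewrite -(mulKV x y); apply: rU => //=.
  by case: (fq) => -> _; rewrite quotientV // rx mulVg.
(* If no coset were dense enough, summing over those that meet [X] would give this bound, whereas
   [U0] exceeds [X] by less than [haar X / D%:R]. *)
have : haar U0 <= D%:R * haar (U0 `\` X).
  have := haar_fibers fq measurableT us; rewrite setTI -/U0 => ->.
  have -> : U0 `\` X = ~` X `&` U0 by rewrite setDE setIC.
  rewrite (haar_fibers fq (measurableC mX) us) mulr_sumr; apply: ler_sum => q _.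
  rewrite setTI leNgt setIC -setDE; apply/negP => lt_q; apply: nq.
  by exists q; split.
apply/negP; rewrite -ltNge haarD // (setIidr XU0).
have U0le : haar U0 <= haar U by exact: le_haar.
have XU0le : haar X <= haar U0 by exact: le_haar.
apply: lt_le_trans XU0le; rewrite mulrC -ltr_pdivlMr ?ltr0n //.
by rewrite ltrBlDl; apply: le_lt_trans UX.
Qed.

Lemma cubic_coset_sub (Q : finGroupType) (r : G -> Q) (q : Q) : finite_quotient mul r ->
    cubic_threshold%:R * haar (r @^-1` [set q] `\` X) < haar (r @^-1` [set q]) ->
  r @^-1` [set q] `<=` X.
Proof.
move=> fq dense z rz; apply: contrapT => z3.
have mX := closed_borel cubic_closed.
have rM := proj1 fq.
have mr (Q' : finGroupType) (r' : G -> Q') (E : set Q') : finite_quotient mul r' ->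
    measurable (r' @^-1` E : set (borelType G)).
  by move=> fq'; apply: open_borel; exact: quotient_open fq' _.
have [y [ry y3]] : r @^-1` [set q] `&` X !=set0.
  apply: contrapT => /set0P/negP/negPn/eqP r0; move: dense.
  rewrite haarD ?r0; last exact: mr.
  rewrite /haar measure0 subr0 -/(haar _) -[ltRHS]mul1r ltNge => /negP; apply.
  by rewrite ler_wpM2r ?haar_ge0 // ler1n.
(* A finer quotient in which the cube of [z] stays nontrivial; its kernel lies in that of [r], so
   the coset is a union of fibres of [r1]. *)
have /(finite_quotient_sub profG)[Q1 [r1 [fq1 r1V]]] :
    nbhs one (r @^-1` [set 1%g] `&` ~` [set mul z (mul z z)]).
  apply: open_nbhs_nbhs; split; last first.
    by split=> /=; [rewrite (quotient1 fq)|move=> /esym].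
  apply: openI; first by case: fq.
  exact/closed_openC/accessible_closed_set1/hausdorff_accessible.
have r1M := proj1 fq1.
pose N := [set a : Q1 | `[< exists2 g, r g = 1%g & r1 g = a >]]%SET.
have NP g : r g = 1%g -> r1 g \in N.
  by move=> rg; rewrite inE; apply/asboolP; exists g.
have gN : group_set N.
  apply/group_setP; split; first by rewrite -(quotient1 fq1) NP // (quotient1 fq).
  move=> a b; rewrite [_ \in _]inE => /asboolP[g rg <-].
  rewrite [_ \in _]inE => /asboolP[h rh <-].
  by rewrite -r1M; apply: NP; rewrite rM rg rh mulg1.
have r1_eq x x' : r1 x = r1 x' -> r x = r x'.
  move=> xx'; have : r (mul (inv x) x') = 1%g.
    by apply: (r1V _ _).1; rewrite /= r1M (quotientV fq1) xx' mulVg.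
  by rewrite rM (quotientV fq) => /eqP; rewrite -eq_mulVg1 => /eqP.
have yN : (r1 y \in 'N(Group gN))%g.
  rewrite inE; apply/fintype.subsetP=> _ /imsetP[a /= aN ->]; move: aN.
  rewrite inE => /asboolP[g rg <-].
  rewrite conjgE -(quotientV fq1) -!r1M; apply: NP.
  by rewrite !rM rg mul1g (quotientV fq) mulVg.
have cube x : (r1 x ^+ 3)%g = r1 (mul x (mul x x)) by rewrite !r1M expgS expg2.
have fiberN (B : {set Q1}) : B \subset N ->
    haar (r1 @^-1` [set a | ((r1 y)^-1 * a)%g \in B]) = #|B|%:R * haar (r1 @^-1` [set 1%g]).
  move=> /fintype.subsetP BN; have := haar_quotient fq1 (B := (r1 y *: B)%g).
  rewrite card_lcoset => <-.
    by congr haar; apply/seteqP; split=> x /=; rewrite mem_lcoset.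
  move=> a; rewrite mem_lcoset => /BN; rewrite inE => /asboolP[g _ r1g].
  by exists (mul y g); rewrite r1M r1g mulKVg.
have r1q : r @^-1` [set q] = r1 @^-1` [set a | ((r1 y)^-1 * a)%g \in N].
  apply/seteqP; split=> x /=.
    move=> rx; rewrite -(quotientV fq1) -r1M; apply: NP.
    by rewrite rM (quotientV fq) rx ry mulVg.
  rewrite inE => /asboolP[g rg r1g]; rewrite -ry (r1_eq x (mul y g)) ?rM ?rg ?mulg1 //.
  by rewrite r1M r1g mulKVg.
pose B := [set a in N | ((r1 y * a) ^+ 3 != 1)%g]%SET.
have BN : B \subset N by apply/fintype.subsetP=> a; rewrite inE => /andP[].
(* A nontrivial cube in [Q1] comes only from a nontrivial cube in [G], so the fibres over the bad
   elements lie outside [X]; dividing measures by that of the kernel of [r1] gives cardinals. *)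
have small : (cubic_threshold * #|B| <= #|N|)%N.
  have le_B : #|B|%:R * haar (r1 @^-1` [set 1%g]) <= haar (r @^-1` [set q] `\` X).
    rewrite -fiberN //; apply: le_haar; first exact: mr.
      by apply: measurableD => //; exact: mr.
    move=> x /=; rewrite inE mulKVg => /andP[xN x3]; have rx : (r @^-1` [set q]) x by rewrite r1q.
    by split=> // Xx; move: x3; rewrite cube Xx (quotient1 fq1) eqxx.
  move: dense; rewrite [in ltRHS]r1q fiberN // => dense.
  rewrite leqNgt; apply/negP => lt_N; move: dense; apply/negP; rewrite -leNgt.
  apply: le_trans (ler_wpM2l _ le_B); rewrite ?ler0n // mulrA -natrM.
  by rewrite ler_wpM2r ?haar_ge0 // ler_nat ltnW.
have y31 : (r1 y ^+ 3 = 1)%g by rewrite cube y3 (quotient1 fq1).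
have zN : ((r1 y)^-1 * r1 z)%g \in N by move: rz; rewrite r1q.
have := cubic_coset yN y31 small zN; rewrite mulKVg cube => /r1V[_] /=.
exact.
Qed.
End CubicHaar.

Local Open Scope ereal_scope.

Theorem theorem3p5 (R : realType) (G : ptopologicalType)
  (mul : G -> G -> G) (inv : G -> G) (one : G)
  (mu : {measure set (borelType G) -> \bar R}) :
  is_profinite_group mul inv one ->
  is_normalized_haar mul mu ->
  0 < mu [set x : G | mul x (mul x x) = one] ->
  [set x : G | mul x (mul x x) = one]° !=set0.
Proof.
move=> profG haarG X0.
have [Q [r [q [fq dense]]]] := @cubic_dense_coset _ _ _ _ _ _ profG haarG cubic_threshold X0 isT.
have sub := cubic_coset_sub profG haarG fq dense.
(* The strict inequality in [dense] excludes an empty fibre. *)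
have [x rx] : r @^-1` [set q] !=set0.
  apply: contrapT => /set0P/negP/negPn/eqP r0; move: dense.
  by rewrite r0 set0D /haar measure0 mulr0 ltxx.
exists x; apply: (filterS sub); apply: open_nbhs_nbhs; split=> //.
exact: (quotient_open profG fq).
Qed.
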